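(* Let $d$ be a positive integer. For any $3$-design POVM $\pi_y$ on a $d$-dimensional complex Hilbert space, the informational power satisfies $W(\pi_y)\le W_3(d)$, where $$W_3(d) := \ln\frac{2d}{d+2} + 2\,\frac{\ln\frac{d+2}{2}}{d(d+1)}.$$
   Context: Let $\mathcal{H}$ be a $d$-dimensional complex Hilbert space. A state is a positive semidefinite operator $\rho$ on $\mathcal{H}$ with $\operatorname{Tr}[\rho]\le 1$; an effect is a positive semidefinite operator $\pi \le \mathbb{1}_d$. An ensemble is a measurable function $x\mapsto\rho_x$ from the reals to states with $\int \operatorname{Tr}[\rho_x]\,dx = 1$. A POVM is a measurable function $y\mapsto\pi_y$ from the reals to effects with $\int \pi_y\,dy = \mathbb{1}_d$. Finite ensembles and finite POVMs are included (sums in place of integrals, or equivalently step functions). A POVM $\pi_y$ is a $t$-design POVM if the ensemble $\pi_y/d$ is a spherical quantum $t$-design, i.e. for every integer $1\le k\le t$, $\int \frac{\pi_y^{\otimes k}}{\operatorname{Tr}[\pi_y]^{k-1}}\,dy = d\binom{d-1+k}{k}^{-1} P_{\mathrm{sym}}$, where $P_{\mathrm{sym}}$ is the orthogonal projector onto the symmetric subspace of $\mathcal{H}^{\otimes k}$ (the right-hand side is $d$ times the corresponding average over pure states distributed with the uniform (Haar) measure on the unit sphere); the integrand is $0$ where $\pi_y=0$. For an ensemble $\rho_x$ and a POVM $\pi_y$, let $p_{x,y}=\operatorname{Tr}[\rho_x\pi_y]$ with marginals $p_x,p_y$; the mutual information is $I(\rho_x,\pi_y) := \iint p_{x,y}\ln\frac{p_{x,y}}{p_xp_y}\,dx\,dy$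 (with $0\ln 0=0$). The informational power is $W(\pi_y) := \sup_{\rho_x} I(\rho_x,\pi_y)$, the supremum being over all ensembles. *)

(* Defs.v *)
(* The d-dimensional Hilbert space is C^d with its standard inner product;
   operators are matrices over C = R[i]. *)
From HB Require Import structures.
From mathcomp Require Import all_boot all_order all_algebra all_fingroup.
From mathcomp Require Import all_classical all_reals all_analysis.
From mathcomp Require Import complex.

Set Implicit Arguments.
Unset Strict Implicit.
Unset Printing Implicit Defensive.

Import Order.TTheory GRing.Theory Num.Theory.
Import numFieldNormedType.Exports.

Local Open Scope classical_set_scope.
Local Open Scope ring_scope.
Local Open Scope sesquilinear_scope.

Section Operators.
Context {R : realType}.

(* [0 <= z] in [R[i]] means that [z] is real and nonnegative, so this forces
   [A] to be Hermitian. *)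
Definition psdmx n (A : 'M[R[i]]_n) : Prop :=
  forall v : 'rV[R[i]]_n, 0 <= (v *m A *m v ^t*) 0 0.

Definition is_state n (A : 'M[R[i]]_n) : Prop := psdmx A /\ \tr A <= 1.

Definition is_effect n (A : 'M[R[i]]_n) : Prop := psdmx A /\ psdmx (1%:M - A).

Definition measurable_mx m n (F : R -> 'M[R[i]]_(m, n)) : Prop :=
  forall i j,
    measurable_fun [set: measurableTypeR R] (fun x => complex.Re (F x i j)) /\
    measurable_fun [set: measurableTypeR R] (fun x => complex.Im (F x i j)).

(* Entrywise Lebesgue integral.  The integrals are extended-real valued and
   +oo - +oo is -oo, so equality with a finite number for a measurable [F]
   includes integrability. *)
Definition has_mx_integral m n (F : R -> 'M[R[i]]_(m, n))
    (A : 'M[R[i]]_(m, n)) : Prop :=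
  forall i j,
    (\int[@lebesgue_measure R]_x (complex.Re (F x i j))%:E
       = (complex.Re (A i j))%:E)%E /\
    (\int[@lebesgue_measure R]_x (complex.Im (F x i j))%:E
       = (complex.Im (A i j))%:E)%E.

End Operators.

Section SymmetricSubspace.
Context {R : realType}.
Variables (d k : nat).

(* The k-th tensor power of C^d has the product basis
   e_(f 0) (x) ... (x) e_(f (k-1)), for f : {ffun 'I_k -> 'I_d}; matrix indices
   enumerate these f through [enum_val]. *)
Definition tens_dim : nat := #|{: {ffun 'I_k -> 'I_d}}|.

Definition tens_pow (A : 'M[R[i]]_d) : 'M[R[i]]_tens_dim :=
  \matrix_(a, b)
    \prod_(l < k) A ((enum_val a : {ffun 'I_k -> 'I_d}) l)
                    ((enum_val b : {ffun 'I_k -> 'I_d}) l).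

(* The operator permuting the k tensor factors according to [s]. *)
Definition tens_perm (s : 'S_k) : 'M[R[i]]_tens_dim :=
  \matrix_(a, b)
    ((enum_val b : {ffun 'I_k -> 'I_d}) ==
     [ffun l => (enum_val a : {ffun 'I_k -> 'I_d}) (s l)])%:R.

(* Row space = the vectors fixed by all permutations of the tensor factors. *)
Definition sym_space : 'M[R[i]]_tens_dim :=
  (\bigcap_(s : 'S_k) eigenspace (tens_perm s) 1)%MS.

Definition Psym : 'M[R[i]]_tens_dim := proj_ortho sym_space.

End SymmetricSubspace.

Section Information.
Context {R : realType}.
Variable d : nat.
Implicit Types rho E : R -> 'M[R[i]]_d.

Definition is_ensemble rho : Prop :=
  [/\ measurable_mx rho,
      forall x, is_state (rho x) &
      (\int[@lebesgue_measure R]_x (complex.Re (\tr (rho x)))%:E = 1)%E].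

Definition is_povm E : Prop :=
  [/\ measurable_mx E,
      forall y, is_effect (E y) &
      has_mx_integral E 1%:M].

(* Where E y = 0 the integrand is 0, since k >= 1 makes [tens_pow k 0 = 0]. *)
Definition is_design_povm (t : nat) E : Prop :=
  is_povm E /\
  forall k : nat, (1 <= k <= t)%N ->
    has_mx_integral (fun y => (\tr (E y) ^+ k.-1)^-1 *: tens_pow k (E y))
                    ((d%:R / 'C((d - 1 + k)%N, k)%:R) *: Psym d k).

Definition joint rho E (x y : R) : R := complex.Re (\tr (rho x *m E y)).

Definition marginal1 rho E (x : R) : R :=
  Rintegral (@lebesgue_measure R) setT (fun y => joint rho E x y).

Definition marginal2 rho E (y : R) : R :=
  Rintegral (@lebesgue_measure R) setT (fun x => joint rho E x y).

(* 0 ln 0 = 0 holds automatically, the logarithm being a total function. *)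
Definition mutual_info rho E : \bar R :=
  (\int[(@lebesgue_measure R) \x (@lebesgue_measure R)]_z
     (joint rho E z.1 z.2 *
      ln (joint rho E z.1 z.2 /
          (marginal1 rho E z.1 * marginal2 rho E z.2)))%:E)%E.

Definition informational_power E : \bar R :=
  ereal_sup [set mutual_info rho E | rho in [set rho | is_ensemble rho]].

End Information.

Definition W3 (R : realType) (d : nat) : R :=
  ln (2 * d%:R / (d%:R + 2)) +
  2 * (ln ((d%:R + 2) / 2) / (d%:R * (d%:R + 1))).

(* Main.v *)
(* Write t = d Tr[sigma pi] / Tr[pi] for a normalized state sigma.  By Gibbs'
   inequality the mutual information only grows if the output marginal is replaced
   by Tr[pi_y] / d, so it is at most the average over x of E[t ln t], where y is
   drawn from the density Tr[pi_y] / d.  On [0, d] the function t ln t lies below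
   the cubic that agrees with it at 0 and d and is tangent to it at a = 2d / (d + 2).
   The 3-design property evaluates the expectation of this cubic in terms of
   Tr[sigma^2] and Tr[sigma^3]; by Tr[sigma (1 - sigma)^2] >= 0 the value is
   largest for pure states, where it equals W_3(d). *)
Require Import Defs.
From mathcomp Require Import all_boot all_order all_algebra all_fingroup.
From mathcomp Require Import all_classical all_reals all_analysis.
From mathcomp Require Import measurable_realfun complex ring lra.

Set Implicit Arguments.
Unset Strict Implicit.
Unset Printing Implicit Defensive.

Import Order.TTheory GRing.Theory Num.Theory.
Import numFieldNormedType.Exports.

Local Open Scope classical_set_scope.
Local Open Scope ring_scope.
Local Open Scope sesquilinear_scope.

Local Notation Re := complex.Re.
Local Notation Im := complex.Im.

(** * A quadratic upper bound of the logarithm *)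

Section LogBound.
Context {R : realType}.
Implicit Types (a b s t u x : R) (f g : R -> R).

Lemma ge0_is_derive_le f g a b :
  (forall x, a <= x <= b -> is_derive x (1 : R) f (g x)) ->
  (forall x, a < x < b -> 0 <= g x) -> a <= b -> f a <= f b.
Proof.
move=> fg g0 ab.
apply: (@ger0_derive1_le_cc _ f a b) => //; rewrite ?in_itv /= ?lexx ?ab //.
- move=> x; rewrite in_itv /= => /andP[ax xb].
  by have [] := fg x; rewrite ?(ltW ax) ?(ltW xb).
- move=> x; rewrite in_itv /= => axb; have /andP[ax xb] := axb.
  rewrite derive1E (@derive_val _ _ _ _ _ _ _ (fg x _)) ?(ltW ax) ?(ltW xb) //.
  exact: g0.
- apply: derivable_within_continuous => x; rewrite in_itv /= => /fg [].
  by [].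
Qed.

(* The [k] for which [(x - 1) + k * (x - 1) ^+ 2] agrees with [ln x] at [u]. *)
Definition ln_curv u : R := (ln u - (u - 1)) / (u - 1) ^+ 2.

Let gap k x : R := (x - 1) + k * (x - 1) ^+ 2 - ln x.

Let is_derive_gap k x : 0 < x ->
  is_derive x (1 : R) (gap k) ((x - 1) * (x^-1 + 2 * k)).
Proof.
move=> x0; have dl := is_derive1_ln x0.
rewrite /gap; apply: is_derive_eq.
rewrite /GRing.scale /= !(mulr1, mul1r, mulr0, addr0, subr0, add0r, oppr0).
field; lra.
Qed.

Let gap1 k : gap k 1 = 0.
Proof. by rewrite /gap subrr expr0n /= mulr0 ln1 addr0 subr0. Qed.

(** The upper bound is [ln u <= u - 1]. For the lower one, [ln x - (x - 1) + (x - 1) ^+ 2 / 2]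
    vanishes at 1 and has derivative [(x - 1) ^+ 2 / x >= 0]. *)
Lemma ln_curv_bounds u : 1 < u -> - 2^-1 <= ln_curv u <= 0.
Proof.
move=> u1; have u0 : 0 < u - 1 by lra.
have u2 : 0 < (u - 1) ^+ 2 by rewrite exprn_gt0.
rewrite /ln_curv ler_pdivlMr // ler_pdivrMr // mul0r; apply/andP; split; last first.
  by have := @le_ln1Dx R (u - 1) ltac:(lra); rewrite addrC subrK; lra.
have : - gap (- 2^-1) 1 <= - gap (- 2^-1) u.
  apply: (@ge0_is_derive_le (fun x => - gap (- 2^-1) x)
           (fun x => - ((x - 1) * (x^-1 + 2 * - 2^-1)))) => [x /andP[x1 _]|x /andP[x1 _]|]; last lra.
    have := @is_derive_gap (- 2^-1) x ltac:(lra) => ?; exact: is_deriveN.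
  have -> : - ((x - 1) * (x^-1 + 2 * - 2^-1)) = (x - 1) ^+ 2 / x by field; lra.
  by rewrite divr_ge0 ?sqr_ge0 //; lra.
rewrite gap1 /gap; lra.
Qed.

(* [gap] has a double zero at [1] and a simple one at [u]; by [ln_curv_bounds] its
   other critical point [- 1 / (2 k)] is at least [1]. *)
Lemma ln_le_quad u s : 1 < u -> 0 < s <= u ->
  ln s <= (s - 1) + ln_curv u * (s - 1) ^+ 2.
Proof.
move=> u1 /andP[s0 su]; set k := ln_curv u.
have /andP[k1 k0] := ln_curv_bounds u1; rewrite -/k in k1 k0.
suff : 0 <= gap k s by rewrite /gap; lra.
have dgap x : 0 < x -> is_derive x (1 : R) (fun x => - gap k x)
    (- ((x - 1) * (x^-1 + 2 * k))).
  by move=> x0; have := @is_derive_gap k x x0 => ?; exact: is_deriveN.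
have gapu : gap k u = 0.
  by rewrite /gap /k /ln_curv divfK ?expf_neq0 //; lra.
(* For [x <= 1] one has [x^-1 >= 1 >= - 2 * k], so [gap k] decreases to its zero at 1. *)
have [s1|s1] := leP s 1.
  have : - gap k s <= - gap k 1.
    apply: (@ge0_is_derive_le (fun x => - gap k x)
      (fun x => - ((x - 1) * (x^-1 + 2 * k)))) => [x /andP[sx _]|x /andP[sx x1]|//].
      by apply: dgap; lra.
    rewrite -mulNr mulr_ge0 //; first lra.
    have : 1 <= x^-1 by rewrite invr_ge1 ?inE ?unitfE; lra.
    by lra.
  by rewrite gap1; lra.
have sinv : 0 < s^-1 by rewrite invr_gt0.
(* The test decides on which side of the second critical point [s] lies: before it [gap k] increases
   from its zero at 1, after it [gap k] decreases to its zero at [u]. *)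
have [sk|sk] := leP (- 2 * k) s^-1.
  rewrite -(gap1 k).
  apply: (@ge0_is_derive_le (gap k) (fun x => ((x - 1) * (x^-1 + 2 * k))))
    => [x /andP[x1 _]|x /andP[x1 xs]|]; last exact: ltW.
    by apply: is_derive_gap; lra.
  have : s^-1 <= x^-1 by rewrite lef_pV2 ?posrE; lra.
  by move=> h; rewrite mulr_ge0 //; lra.
have : - gap k s <= - gap k u.
  apply: (@ge0_is_derive_le (fun x => - gap k x)
      (fun x => - ((x - 1) * (x^-1 + 2 * k)))) => [x /andP[sx _]|x /andP[sx x1]|//].
    by apply: dgap; lra.
  have : x^-1 <= s^-1 by rewrite lef_pV2 ?posrE; lra.
  by move=> h; rewrite -mulrN mulr_ge0 //; lra.
by rewrite gapu; lra.
Qed.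

End LogBound.

(** * Bounding the mutual information *)

(** Inversion is total with value 0 at 0 and continuous on the open set of nonzero reals;
    measurability is checked on these two pieces. *)
Lemma measurable_funV d (T : measurableType d) (R : realType) (f : T -> R) :
  measurable_fun setT f -> measurable_fun setT (fun x => (f x)^-1).
Proof.
suff minv : measurable_fun setT (@GRing.inv R) by exact: measurableT_comp.
have mn0 : measurable [set x : R | x != 0].
  by rewrite (_ : [set x | x != 0] = ~` [set 0]); [exact: measurableC|apply/seteqP; split=> x /eqP].
rewrite (_ : setT = [set 0] `|` [set x : R | x != 0]); last first.
  by apply/seteqP; split=> x //= _; have [->|] := eqVneq x 0; [left|right].
apply/measurable_funU => //; split; first exact: measurable_fun_set1.
apply: open_continuous_measurable_fun; last by move=> x; rewrite inE => /inv_continuous.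
rewrite (_ : [set x | x != 0] = ~` [set 0]); last by apply/seteqP; split=> x /eqP.
exact/closed_openC/closed_eq.
Qed.

Section IntegralBound.
Context d (T : measurableType d) (R : realType) (mu : {measure set T -> \bar R}).

(* Unlike [le_integral], [f] may have an infinite negative part. *)
Lemma le_integral_integrable (f g : T -> \bar R) : measurable_fun setT f ->
  mu.-integrable setT g -> (forall x, f x <= g x)%E ->
  (\int[mu]_x f x <= \int[mu]_x g x)%E.
Proof.
move=> mf ig fg; have mg := measurable_int _ ig.
rewrite (integralE _ _ f) (integralE _ _ g); apply: leeB.
  apply: ge0_le_integral => //; try exact: measurable_funepos.
  by move=> x _; rewrite !funeposE ge_max le_max fg /= le_max lexx orbT.
apply: ge0_le_integral => //; try exact: measurable_funeneg.
by move=> x _; rewrite !funenegE ge_max !le_max lexx orbT leeN2 fg.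
Qed.

End IntegralBound.

Section MutualInformationBound.
Context d1 d2 (T1 : measurableType d1) (T2 : measurableType d2) (R : realType).
Variables (m1 : {sigma_finite_measure set T1 -> \bar R})
          (m2 : {sigma_finite_measure set T2 -> \bar R}).
(** In the application [p] is the joint density, [P] its input marginal, [q] the reference output
    density [Tr[pi_y] / d], and [r] a bounded majorant of [ln] on the range of the likelihood
    ratio. *)
Variables (p : T1 * T2 -> R) (P : T1 -> R) (q : T2 -> R) (r : R -> R).
Variables (D K W : R).
Hypotheses (mp : measurable_fun setT p) (mP : measurable_fun setT P)
  (mq : measurable_fun setT q) (mr : measurable_fun setT r).
Hypotheses (p0 : forall z, 0 <= p z) (P0 : forall x, 0 <= P x)
  (q0 : forall y, 0 <= q y) (D0 : 0 <= D).
Hypothesis p_le : forall x y, p (x, y) <= D * (P x * q y).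
Hypothesis int_p : forall x, (\int[m2]_y (p (x, y))%:E = (P x)%:E)%E.
Hypothesis int_P : (\int[m1]_x (P x)%:E = 1)%E.
Hypothesis int_q : (\int[m2]_y (q y)%:E = 1)%E.
Hypothesis ln_le_r : forall t, 0 < t <= D -> ln t <= r t.
Hypothesis r_le : forall t, 0 <= t <= D -> `|r t| <= K.
Hypothesis int_pr : forall x,
  (\int[m2]_y (p (x, y) * r (p (x, y) / (P x * q y)))%:E <= (W * P x)%:E)%E.

(** [Q] is the true output marginal, while [t] is the likelihood ratio against the reference density
    [q]. *)
Let Q y := fine (\int[m1]_x (p (x, y))%:E).
Let t z := p z / (P z.1 * q z.2).

(* Where [Q y = 0] the mutual information integrand is [0] by junk values, so
   [k y] only has to dominate [1 - r]; there [p (x, y) = 0] for almost all [x],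
   so the value does not contribute to the integral. *)
Let k y := if Q y == 0 then K + 1 else q y / Q y.

Let mEp : measurable_fun setT (EFin \o p).
Proof. exact/measurable_EFinP. Qed.

Let Ep0 z : (0 <= (EFin \o p) z)%E.
Proof. by rewrite /= lee_fin. Qed.

Let QE y : (\int[m1]_x (p (x, y))%:E = (Q y)%:E)%E.
Proof.
have mpy : measurable_fun setT (fun x => (p (x, y))%:E).
  by apply/measurable_EFinP; exact: measurable_fun_pair1.
rewrite /Q fineK // ge0_fin_numE; last first.
  by apply: integral_ge0 => x _; rewrite lee_fin.
(* Finiteness of the marginal comes from [p_le], which dominates [p] by a multiple of the integrable
   [P]. *)
apply: (@le_lt_trans _ _ (\int[m1]_x ((D * q y)%:E * (P x)%:E))%E).
  apply: ge0_le_integral => //.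
  - by move=> x _; rewrite lee_fin.
  - by apply: emeasurable_funM => //; exact/measurable_EFinP.
  - by move=> x _; rewrite -EFinM lee_fin -mulrA [q y * _]mulrC p_le.
rewrite ge0_integralZl_EFin //; last 2 first.
- exact/measurable_EFinP.
- by rewrite mulr_ge0.
- by rewrite int_P mule1 ltry.
- by move=> x _; rewrite lee_fin.
Qed.

Let Q0 y : 0 <= Q y.
Proof. by rewrite -lee_fin -QE; apply: integral_ge0 => x _; rewrite lee_fin. Qed.

Let mQ : measurable_fun setT Q.
Proof.
apply/measurable_EFinP.
have := @measurable_fun_fubini_tonelli_G _ _ _ _ _ m1 _ mEp Ep0.
by apply: eq_measurable_fun => y _; rewrite /fubini_G /= QE.
Qed.

Let K0 : 0 <= K.
Proof. by apply: le_trans (r_le (t := 0) _); rewrite ?normr_ge0 // lexx. Qed.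

Let mk : measurable_fun setT k.
Proof.
apply: measurable_fun_ifT => //.
- exact: measurable_fun_eqr.
- by apply: measurable_funM => //; exact: measurable_funV.
Qed.

Let mt : measurable_fun setT t.
Proof.
apply: measurable_funM => //; apply: measurable_funV.
apply: measurable_funM; first exact: measurableT_comp.
exact: measurableT_comp.
Qed.

Let k0 y : 0 <= k y.
Proof. by rewrite /k; case: ifP => _; rewrite ?divr_ge0 ?addr_ge0. Qed.

Let int2_p : (\int[m1 \x m2]_z (p z)%:E = 1)%E.
Proof.
rewrite (@fubini_tonelli1 _ _ _ _ _ m1 m2 (EFin \o p)) // -int_P.
by apply: eq_integral => x _; rewrite /fubini_F /= int_p.
Qed.

Let integrable_p : (m1 \x m2)%E.-integrable setT (EFin \o p).
Proof.
apply/integrableP; split => //.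
under eq_integral do rewrite gee0_abs //.
by rewrite int2_p ltry.
Qed.

Let mpk : measurable_fun setT (fun z => p z * k z.2).
Proof. by apply: measurable_funM => //; exact: measurableT_comp. Qed.

(** Integrating over [x] first leaves [k y * Q y], which is [q y] where [Q y] is nonzero and 0
    elsewhere, hence at most [q y]. *)
Let int_pk : (\int[m1 \x m2]_z (p z * k z.2)%:E <= 1)%E.
Proof.
rewrite fubini_tonelli2 /=; last 2 first.
- exact/measurable_EFinP.
- by move=> z; rewrite lee_fin mulr_ge0.
have FE y : fubini_G m1 (fun z => (p z * k z.2)%:E) y = (k y * Q y)%:E.
  rewrite /fubini_G /= EFinM -QE -ge0_integralZl_EFin //.
  - by apply: eq_integral => x _; rewrite -EFinM mulrC.
  - by move=> x _; rewrite lee_fin.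
  - by apply/measurable_EFinP; exact: measurable_fun_pair1.
rewrite -int_q; apply: ge0_le_integral => //.
- by move=> y _; rewrite FE lee_fin mulr_ge0.
- apply: (eq_measurable_fun (fun y => (k y * Q y)%:E)) => [y _|]; first by rewrite FE.
  by apply/measurable_EFinP; exact: measurable_funM.
- exact/measurable_EFinP.
- move=> y _; rewrite FE lee_fin /k; case: eqP => [->|/eqP Qy].
    by rewrite mulr0.
  by rewrite divfK.
Qed.

Let integrable_pk : (m1 \x m2)%E.-integrable setT (fun z => (p z * k z.2)%:E).
Proof.
apply/integrableP; split; first exact/measurable_EFinP.
under eq_integral do rewrite gee0_abs ?lee_fin ?mulr_ge0 //.
exact: le_lt_trans int_pk (ltry _).
Qed.

Let t_ge0 z : 0 <= t z.
Proof. by rewrite divr_ge0 ?mulr_ge0. Qed.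

Let t_le z : t z <= D.
Proof.
(* With a zero denominator [t z] is 0 by the convention [0^-1 = 0]. *)
rewrite /t; have [->|n0] := eqVneq (P z.1 * q z.2) 0; first by rewrite invr0 mulr0.
by rewrite ler_pdivrMr ?lt_def ?n0 ?mulr_ge0 //; case: z n0 => x y _; exact: p_le.
Qed.

Let mprt : measurable_fun setT (fun z => p z * r (t z)).
Proof. by apply: measurable_funM => //; exact: measurableT_comp. Qed.

Let integrable_prt : (m1 \x m2)%E.-integrable setT (fun z => (p z * r (t z))%:E).
Proof.
apply: (le_integrable _ _ _ (integrableZl _ K integrable_p)) => //.
  exact/measurable_EFinP.
move=> z _ /=; rewrite lee_fin normrM normrM mulrC (ger0_norm K0).
by rewrite ler_wpM2r // r_le // t_ge0 t_le.
Qed.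

Let int2_prt : (\int[m1 \x m2]_z (p z * r (t z))%:E <= W%:E)%E.
Proof.
have iP : m1.-integrable setT (EFin \o P).
  apply/integrableP; split; first exact/measurable_EFinP.
  under eq_integral do rewrite gee0_abs ?lee_fin //.
  by rewrite int_P ltry.
rewrite -(integral12_prod_meas1 integrable_prt) -[leRHS]mule1 -int_P -integralZl //.
apply: le_integral => //.
- exact: integrable_fubini_F.
- exact: integrableZl.
- by move=> x _; rewrite -EFinM; exact: int_pr.
Qed.

(* Gibbs' inequality: replacing the marginal [Q] by [q] costs at most
   [p * ln (q / Q) <= p * (q / Q - 1)], which integrates to at most [0]. *)
Lemma mutual_info_le :
  (\int[m1 \x m2]_z (p z * ln (p z / (P z.1 * Q z.2)))%:E <= W%:E)%E.
Proof.
have mf : measurable_fun setT (fun z => p z * ln (p z / (P z.1 * Q z.2))).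
  apply: measurable_funM => //; apply: measurableT_comp; first exact: measurable_ln.
  apply: measurable_funM => //; apply: measurable_funV.
  apply: measurable_funM; first exact: measurableT_comp.
  exact: measurableT_comp.
have ih : (m1 \x m2)%E.-integrable setT (EFin \o (fun z => p z * k z.2 - p z)).
  exact: (integrableB measurableT integrable_pk integrable_p).
have ig : (m1 \x m2)%E.-integrable setT
    (fun z => (p z * r (t z))%:E + (p z * k z.2 - p z)%:E)%E.
  exact: integrableD.
apply: (@le_trans _ _ (\int[m1 \x m2]_z
    ((p z * r (t z))%:E + (p z * k z.2 - p z)%:E))%E).
  apply: le_integral_integrable => //; first exact/measurable_EFinP.
  move=> [x y]; rewrite -EFinD lee_fin /=.
  have [->|pn0] := eqVneq (p (x, y)) 0; first by rewrite !mul0r subrr addr0.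
  have pxy : 0 < p (x, y) by rewrite lt_def pn0 p0.
  have Pq : P x * q y != 0.
    by apply: contraTneq pxy => e; rewrite -leNgt (le_trans (p_le _ _)) // e mulr0.
  have Pq0 : 0 < P x * q y by rewrite lt_def Pq mulr_ge0.
  have /andP[Px qy] : (0 < P x) && (0 < q y).
    by move: Pq; rewrite mulf_eq0 negb_or !lt_def P0 q0 !andbT.
  have t0 : 0 < t (x, y) by rewrite divr_gt0.
  rewrite addrA -mulrDr -[X in _ - X]mulr1 -mulrBr ler_wpM2l //.
  (* When [Q y = 0] the left side is [ln 0 = 0] and the right side is [r + (K + 1) - 1], nonnegative
     because [r >= - K]. *)
  rewrite /k; case: eqP => [->|/eqP Qy].
    rewrite mulr0 invr0 mulr0 ln0 //.
    have := r_le (t := t (x, y)); by rewrite t_ge0 t_le => /(_ isT); rewrite ler_norml => /andP[]; lra.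
  have Qy0 : 0 < Q y by rewrite lt_def Qy Q0.
  (* The logarithm splits into [ln t <= r t] and [ln (q / Q) <= q / Q - 1]. *)
  have -> : p (x, y) / (P x * Q y) = t (x, y) * (q y / Q y).
    by rewrite /t /=; field; rewrite ?gt_eqF.
  have qQ : 0 < q y / Q y by rewrite divr_gt0.
  rewrite lnM ?posrE // -addrA lerD //; first by rewrite ln_le_r // t0 t_le.
  have := @le_ln1Dx R (q y / Q y - 1); rewrite [1 + _]addrC subrK; apply; lra.
(* The Gibbs correction integrates to at most [1 - 1 = 0], by [int_pk] and [int2_p]. *)
rewrite integralD_EFin // integralB_EFin // int2_p.
rewrite -[leRHS]adde0 leeD //.
rewrite -(subee (x := 1%E)) // leeB //.
Qed.

End MutualInformationBound.

(** * Traces of positive semidefinite matrices *)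

Section Positive.
Context {R : realType} {n : nat}.
Local Notation C := R[i].
Implicit Types A B : 'M[C]_n.

Lemma psdmx_row_ge0 m A (B : 'M[C]_(m, n)) i : psdmx A -> 0 <= (B *m A *m B ^t*) i i.
Proof.
move=> /(_ (row i B)); rewrite -row_mul mxE [in X in _ -> X]mxE.
by congr (0 <= _); apply: eq_bigr => j _; rewrite !mxE.
Qed.

Lemma mxtrace_psdmx_ge0 A : psdmx A -> 0 <= \tr A.
Proof.
move=> Apsd; apply: sumr_ge0 => i _.
have := psdmx_row_ge0 1%:M i Apsd.
by rewrite trmx1 map_mx1 mul1mx mulmx1.
Qed.

Lemma psdmx_conj m A (B : 'M[C]_(m, n)) : psdmx A -> psdmx (B *m A *m B ^t*).
Proof.
by move=> Apsd v; have := psdmx_row_ge0 (v *m B) 0 Apsd;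
  rewrite trmx_mul map_mxM !mulmxA.
Qed.

(** Polarization: positivity makes [q u v + q v u] real for all [u] and [v]. Testing on [e_i] with
    [e_j], then with ['i *: e_j], relates the real and imaginary parts of [A i j] and [A j i]. *)
Lemma psdmx_herm A : psdmx A -> A ^t* = A.
Proof.
move=> Apsd.
pose q (u v : 'rV[C]_n) := (u *m A *m v ^t*) 0 0.
have qDD u v : q (u + v) (u + v) = q u u + q v v + (q u v + q v u).
  rewrite /q linearD map_mxD /= !(mulmxDl, mulmxDr) !mxE; ring.
have qreal u v : q u v + q v u \is Num.real.
  have : q (u + v) (u + v) \is Num.real by exact: (ger0_real (Apsd (u + v))).
  rewrite qDD => h.
  have -> : q u v + q v u = (q u u + q v v + (q u v + q v u)) - (q u u + q v v) by ring.
  by apply: realB => //; apply: realD; apply: ger0_real; exact: Apsd.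
have qE (c : C) i j : q (delta_mx 0 i) (c *: delta_mx 0 j) = c^* * A i j.
  by rewrite /q linearZ map_mxZ /= trmx_delta map_delta_mx -scalemxAr mxE -rowE -colE !mxE.
have qE' (c : C) i j : q (c *: delta_mx 0 j) (delta_mx 0 i) = c * A j i.
  by rewrite /q trmx_delta map_delta_mx -!scalemxAl mxE -rowE -colE !mxE.
apply/matrixP => i j; rewrite !mxE.
have := qreal (delta_mx 0 i) (1 *: delta_mx 0 j).
have := qreal (delta_mx 0 i) ('i *: delta_mx 0 j).
rewrite !qE !qE' => /CrealP h1 /CrealP h2.
move: h1 h2; rewrite !rmorphD !rmorphM /= !conjCK conjCi rmorph1 !mul1r => h1 h2.
apply: (mulfI (x := 2)); first by rewrite pnatr_eq0.
have {}h1 : (A i j)^* - (A j i)^* = A j i - A i j.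
  apply: (mulfI (neq0Ci C)); move: h1.
  rewrite !mulNr !mulrBr [RHS]addrC => ->.
  by rewrite addrC.
have -> : 2 * (A j i)^* = ((A i j)^* + (A j i)^*) - ((A i j)^* - (A j i)^*) by ring.
by rewrite h2 h1; ring.
Qed.

(** A Hermitian matrix is normal, so the spectral theorem applies; the eigenvalues are diagonal
    entries of [A] conjugated by [U], hence nonnegative. *)
Lemma psdmx_spectral A : psdmx A ->
  exists (U : 'M[C]_n) (l : 'rV_n), [/\ U ^t* *m U = 1%:M,
    forall i, 0 <= l 0 i & A = U ^t* *m diag_mx l *m U].
Proof.
move=> Apsd; set U := spectralmx A; exists U, (spectral_diag A).
have Uu : U \is unitarymx by exact: spectral_unitarymx.
have UU : U *m U ^t* = 1%:M by apply/unitarymxP.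
have AE : A = U ^t* *m diag_mx (spectral_diag A) *m U.
  rewrite -invmx_unitary //; apply/orthomx_spectralP/normalmxP.
  by rewrite psdmx_herm.
split=> //; first exact: mulmx1C.
move=> i; have := psdmx_row_ge0 U i Apsd.
by rewrite {1}AE !mulmxA UU mul1mx -mulmxA UU mulmx1 mxE eqxx.
Qed.

(** In an eigenbasis of [B] the trace is the sum of [D i i * l 0 i] with nonnegative factors, and
    each [D i i] is at most [\tr D = \tr A]. *)
Lemma mxtrace_mul_psdmx A B : psdmx A -> psdmx B -> 0 <= \tr (A *m B) <= \tr A * \tr B.
Proof.
move=> Apsd /psdmx_spectral[U [l [UU l0 ->]]].
set D := U *m A *m U ^t*.
have trA : \tr A = \tr D by rewrite /D mxtrace_mulC mulmxA UU mul1mx.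
have D0 i : 0 <= D i i by exact: psdmx_row_ge0.
have -> : \tr (A *m (U ^t* *m diag_mx l *m U)) = \sum_i D i i * l 0 i.
  rewrite mulmxA mxtrace_mulC !mulmxA -/D.
  by apply: eq_bigr => i _; rewrite mul_mx_diag mxE.
have -> : \tr (U ^t* *m diag_mx l *m U) = \sum_i l 0 i.
  rewrite mxtrace_mulC mulmxA (mulmx1C UU) mul1mx.
  by apply: eq_bigr => i _; rewrite mxE eqxx.
rewrite sumr_ge0 /=; last by move=> i _; rewrite mulr_ge0.
rewrite mulr_sumr; apply: ler_sum => i _; rewrite ler_wpM2r // trA.
by rewrite /mxtrace (bigD1 i) //= lerDl sumr_ge0.
Qed.

(** With [c = \tr A], expand the trace of the positive matrix [(c - A) A (c - A)]; this is the
    unnormalized form of [Tr[sigma (1 - sigma)^2] >= 0]. *)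
Lemma mxtrace_cube_ge A : psdmx A ->
  2 * \tr A * \tr (A *m A) - \tr A ^+ 3 <= \tr (A *m A *m A).
Proof.
move=> Apsd; set c := \tr A.
have /(mxtrace_psdmx_ge0) := psdmx_conj (c%:M - A) Apsd.
have cr : c^* = c by apply/CrealP/ger0_real/mxtrace_psdmx_ge0.
have -> : (c%:M - A) ^t* = c%:M - A.
  by rewrite linearB map_mxB /= (psdmx_herm Apsd) tr_scalar_mx map_scalar_mx /= cr.
rewrite !(mulmxBl, mulmxBr) !mul_scalar_mx -!scalemxAl !mul_mx_scalar.
rewrite !(linearB, linearZ) /= -/c => h; rewrite -subr_ge0.
apply: le_trans h _; rewrite le_eqVlt; apply/orP; left; apply/eqP.
by rewrite /GRing.scale /=; ring.
Qed.

End Positive.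

(** * The symmetric projector *)

Section TensorPower.
Context {R : realType} (d k : nat).
Local Notation C := R[i].
Local Notation idx := {ffun 'I_k -> 'I_d}.
Implicit Types (A B : 'M[C]_d) (s : 'S_k).

Let sum_idx (V : nmodType) (F : idx -> V) :
  \sum_(a < tens_dim d k) F (enum_val a) = \sum_f F f.
Proof. rewrite [RHS](reindex (fun a : 'I_(tens_dim d k) => enum_val a : idx)) //=.
exact/onW_bij/enum_val_bij. Qed.

Lemma tens_pow_mul A B : tens_pow k A *m tens_pow k B = tens_pow k (A *m B).
Proof.
apply/matrixP => a c; rewrite !mxE.
under eq_bigr do rewrite !mxE -big_split /=.
rewrite (sum_idx (fun f => \prod_l (A ((enum_val a : idx) l) (f l) * B (f l) ((enum_val c : idx) l)))).
by rewrite -(bigA_distr_bigA (fun l i => A ((enum_val a : idx) l) i * B i ((enum_val c : idx) l)));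
  apply: eq_bigr => l _; rewrite mxE.
Qed.

Lemma mxtrace_tens_pow A : \tr (tens_pow k A) = \tr A ^+ k.
Proof.
rewrite /mxtrace; under eq_bigr do rewrite mxE.
rewrite (sum_idx (fun f => \prod_l A (f l) (f l))).
by rewrite -(bigA_distr_bigA (fun l i => A i i)) prodr_const card_ord.
Qed.

(** On row vectors [tens_perm d s] sends the basis vector of [f] to that of [f \o s]; precomposition
    reverses the order of products. *)
Lemma tens_perm_mul s s' :
  tens_perm d s *m tens_perm d s' = tens_perm d (s' * s)%g :> 'M[C]_ _.
Proof.
apply/matrixP => a c; rewrite !mxE.
pose b : idx := [ffun l => (enum_val a : idx) (s l)].
rewrite (bigD1 (enum_rank b)) //= big1 => [|e eb]; rewrite !mxE; last first.
  rewrite (_ : enum_val e == _ = false) ?mul0r //; apply: contraNF eb => /eqP eb.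
  by rewrite -(enum_valK e) eb.
rewrite enum_rankK eqxx mul1r addr0; congr (_%:R); congr (nat_of_bool (_ == _)).
by apply/ffunP => l; rewrite !ffunE permM.
Qed.

Lemma tens_perm_adj s : (tens_perm d s) ^t* = tens_perm d s^-1%g :> 'M[C]_ _.
Proof.
apply/matrixP => a b; rewrite !mxE rmorph_nat; congr (_%:R); congr (nat_of_bool _).
apply/eqP/eqP => ->; apply/ffunP => l; rewrite !ffunE ?permKV ?permK //.
Qed.

(** The average over all permutations. It is Hermitian, maps into the symmetric subspace and fixes
    it pointwise, which makes it the orthogonal projector. *)
Let T : 'M[C]_(tens_dim d k) := (k`!%:R)^-1 *: \sum_(s : 'S_k) tens_perm d s.

Let k_neq0 : (k`!%:R : C) != 0.
Proof. by rewrite pnatr_eq0 -lt0n fact_gt0. Qed.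

Let T_mul s : T *m tens_perm d s = T.
Proof.
rewrite /T -scalemxAl mulmx_suml; congr (_ *: _).
rewrite [RHS](reindex_inj (mulgI s)) /=.
by apply: eq_bigr => s' _; rewrite tens_perm_mul.
Qed.

Let T_adj : T ^t* = T.
Proof.
rewrite /T linearZ map_mxZ /= fmorphV rmorph_nat; congr (_ *: _).
rewrite linear_sum map_mx_sum [RHS](reindex_inj invg_inj) /=.
by apply: eq_bigr => s _; rewrite tens_perm_adj.
Qed.

Let T_sub : (T <= sym_space d k)%MS.
Proof. by apply/sub_bigcapmxP => s _; apply/eigenspaceP; rewrite T_mul scale1r. Qed.

Let mul_T m (W : 'M[C]_(m, tens_dim d k)) : (W <= sym_space d k)%MS -> W *m T = W.
Proof.
move=> /sub_bigcapmxP Ws; rewrite /T -scalemxAr mulmx_sumr.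
under eq_bigr => s _ do rewrite (eigenspaceP (Ws s isT)) scale1r.
by rewrite sumr_const card_Sn -[W *+ _]scaler_nat scalerA mulVf // scale1r.
Qed.

(** The rows of [1 - T] are orthogonal to the symmetric subspace and those of [T] lie in it, so
    [Psym] kills the former and fixes the latter. *)
Lemma PsymE : Psym d k = (k`!%:R)^-1 *: \sum_(s : 'S_k) tens_perm d s :> 'M[C]_ _.
Proof.
rewrite -/T /Psym.
have h0 : (1%:M - T) *m proj_ortho (sym_space d k) = 0.
  apply/proj_ortho_0/orthomx1P; rewrite -[X in X ^t*]mul_T // trmx_mul map_mxM T_adj.
  by rewrite mulmxA mulmxBl mul1mx mul_T // subrr mul0mx.
by rewrite -[LHS]mul1mx -[X in X *m _](subrK T) mulmxDl h0 add0r proj_ortho_id.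
Qed.

Lemma mxtrace_tens_pow_perm A s :
  \tr (tens_pow k A *m tens_perm d s) = \sum_(f : idx) \prod_l A (f (s l)) (f l).
Proof.
rewrite mxtrace_mulC -(sum_idx (fun f => \prod_l A (f (s l)) (f l))).
apply: eq_bigr => a _; rewrite mxE.
pose b : idx := [ffun l => (enum_val a : idx) (s l)].
rewrite (bigD1 (enum_rank b)) //= big1 => [|e eb]; rewrite !mxE; last first.
  rewrite (_ : enum_val e == _ = false) ?mul0r //; apply: contraNF eb => /eqP eb.
  by rewrite -(enum_valK e) eb.
rewrite enum_rankK eqxx mul1r addr0; apply: eq_bigr => l _.
by rewrite ffunE.
Qed.

(** Each inner sum is a product of traces of powers of [A], one for each cycle of [s]; this is made
    explicit below for two and three factors. *)
Lemma mxtrace_tens_pow_Psym A :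
  \tr (tens_pow k A *m Psym d k) =
  (k`!%:R)^-1 * \sum_(s : 'S_k) \sum_(f : idx) \prod_l A (f (s l)) (f l).
Proof.
rewrite PsymE -scalemxAr linearZ mulmx_sumr linear_sum /=; congr (_ * _).
by apply: eq_bigr => s _; rewrite mxtrace_tens_pow_perm.
Qed.

End TensorPower.

(** By cardinality a duplicate-free list of the right size is exhaustive, so sums over ['S_k] can be
    expanded over explicit lists. *)
Lemma perm_index_enum_perm k (s : seq 'S_k) : uniq s -> size s = k`! ->
  perm_eq (index_enum 'S_k) s.
Proof.
move=> us ss; rewrite perm_sym; apply: uniq_perm => //; first exact: index_enum_uniq.
apply: (uniq_min_size us _ _).2 => [x _|]; first exact: mem_index_enum.
by rewrite ss -card_Sn cardT enumT.
Qed.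

(** * Traces against the symmetric projector for two and three tensor factors *)

Section SmallTensorPowers.
Context {R : realType} (d : nat).
Local Notation C := R[i].
Implicit Types (A : 'M[C]_d).

Local Notation i0 := ord0.
Local Notation i1 := (lift ord0 ord0).
Local Notation i2 := (lift ord0 (lift ord0 ord0)).

Let sum_ffun2 (V : nmodType) (G : 'I_d -> 'I_d -> V) :
  \sum_(f : {ffun 'I_2 -> 'I_d}) G (f i0) (f i1) = \sum_i \sum_j G i j.
Proof.
rewrite pair_big /= (reindex (fun ij : 'I_d * 'I_d =>
  [ffun l : 'I_2 => tnth [tuple ij.1; ij.2] l])) /=.
  by apply: eq_bigr => -[i j] _; rewrite !ffunE.
exists (fun f : {ffun 'I_2 -> 'I_d} => (f i0, f i1)) => [[i j] _|f _].
  by rewrite !ffunE.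
apply/ffunP => l; rewrite ffunE (tnth_nth (f ord0)).
by case: l => -[|[|//]] hl; congr (f _); apply/val_inj.
Qed.

Let sum_ffun3 (V : nmodType) (G : 'I_d -> 'I_d -> 'I_d -> V) :
  \sum_(f : {ffun 'I_3 -> 'I_d}) G (f i0) (f i1) (f i2) = \sum_i \sum_j \sum_k G i j k.
Proof.
under [RHS]eq_bigr do rewrite pair_big.
rewrite pair_big /= (reindex (fun ij : 'I_d * ('I_d * 'I_d) =>
  [ffun l : 'I_3 => tnth [tuple ij.1; ij.2.1; ij.2.2] l])) /=.
  by apply: eq_bigr => -[i [j k]] _; rewrite !ffunE.
exists (fun f : {ffun 'I_3 -> 'I_d} => (f i0, (f i1, f i2))) => [[i [j k]] _|f _].
  by rewrite !ffunE.
apply/ffunP => l; rewrite ffunE (tnth_nth (f ord0)).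
by case: l => -[|[|[|//]]] hl; congr (f _); apply/val_inj.
Qed.

Let tperm3E :
  (@tperm 'I_3 i0 i1 i0 = i1) * (@tperm 'I_3 i0 i1 i1 = i0) * (@tperm 'I_3 i0 i1 i2 = i2) *
  (@tperm 'I_3 i0 i2 i0 = i2) * (@tperm 'I_3 i0 i2 i1 = i1) * (@tperm 'I_3 i0 i2 i2 = i0) *
  (@tperm 'I_3 i1 i2 i0 = i0) * (@tperm 'I_3 i1 i2 i1 = i2) * (@tperm 'I_3 i1 i2 i2 = i1).
Proof. by rewrite /= ?(tpermL, tpermR) !tpermD. Qed.

Lemma mxtrace_tens_pow2_Psym A :
  \tr (tens_pow 2 A *m Psym d 2) = 2^-1 * (\tr A ^+ 2 + \tr (A *m A)).
Proof.
have perms : perm_eq (index_enum 'S_2) [:: 1%g; tperm i0 i1].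
  apply: perm_index_enum_perm => //; apply: (@map_uniq _ _ (fun s : 'S_2 => s i0)).
  by rewrite /= perm1 tpermL.
rewrite mxtrace_tens_pow_Psym (perm_big _ perms) /= !big_cons big_nil addr0.
under eq_bigr do rewrite !big_ord_recl big_ord0 mulr1 !perm1.
rewrite (sum_ffun2 (fun i j => A i i * A j j)).
under [X in _ + X]eq_bigr do rewrite !big_ord_recl big_ord0 mulr1 tpermL tpermR.
rewrite (sum_ffun2 (fun i j => A j i * A i j)).
congr (_ * (_ + _)).
  by rewrite expr2 mulr_suml; apply: eq_bigr => i _; rewrite mulr_sumr.
by rewrite exchange_big /=; apply: eq_bigr => i _; rewrite mxE.
Qed.

(** The identity contributes [\tr A ^+ 3], each of the three transpositions [\tr A * \tr (A *m A)],
    and each of the two 3-cycles [\tr (A *m A *m A)]. *)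
Lemma mxtrace_tens_pow3_Psym A :
  \tr (tens_pow 3 A *m Psym d 3) =
  6^-1 * (\tr A ^+ 3 + 3 * \tr A * \tr (A *m A) + 2 * \tr (A *m A *m A)).
Proof.
have perms : perm_eq (index_enum 'S_3) [:: 1; tperm i0 i1; tperm i0 i2;
    tperm i1 i2; tperm i0 i1 * tperm i1 i2; tperm i1 i2 * tperm i0 i1]%g.
  apply: perm_index_enum_perm => //.
  (* The listed permutations are told apart by their images of the first two points. *)
  apply: (@map_uniq _ _ (fun s : 'S_3 => (s i0, s i1))).
  by rewrite /= !permM !perm1 !tperm3E.
have tr2 : \sum_i \sum_j A i j * A j i = \tr (A *m A).
  by apply: eq_bigr => i _; rewrite mxE.
have tr3 : \sum_i \sum_j \sum_k A i j * A j k * A k i = \tr (A *m A *m A).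
  apply: eq_bigr => i _; rewrite !mxE exchange_big; apply: eq_bigr => k _ /=.
  by rewrite mxE mulr_suml.
rewrite mxtrace_tens_pow_Psym (perm_big _ perms) /= !big_cons big_nil addr0.
have ex s : \sum_(f : {ffun 'I_3 -> 'I_d}) \prod_(l < 3) A (f (s l)) (f l) =
    \sum_(f : {ffun 'I_3 -> 'I_d}) A (f (s i0)) (f i0) * A (f (s i1)) (f i1) * A (f (s i2)) (f i2).
  by apply: eq_bigr => f _; rewrite !big_ord_recl big_ord0 mulr1 mulrA.
rewrite !ex !permM !perm1 !tperm3E.
rewrite (sum_ffun3 (fun i j k => A i i * A j j * A k k)).
rewrite (sum_ffun3 (fun i j k => A j i * A i j * A k k)).
rewrite (sum_ffun3 (fun i j k => A k i * A j j * A i k)).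
rewrite (sum_ffun3 (fun i j k => A i i * A k j * A j k)).
rewrite (sum_ffun3 (fun i j k => A k i * A i j * A j k)).
rewrite (sum_ffun3 (fun i j k => A j i * A k j * A i k)).
set t := \tr A; set t2 := \tr (A *m A) in tr2 *; set t3 := \tr (_ *m A) in tr3 *.
have tE : \sum_i A i i = t by [].
have -> : \sum_i \sum_j \sum_k A i i * A j j * A k k = t * (t * t).
  rewrite -{1}tE mulr_suml; apply: eq_bigr => i _; rewrite -{1}tE mulr_suml mulr_sumr.
  by apply: eq_bigr => j _; rewrite -tE !mulr_sumr; apply: eq_bigr => k _; rewrite mulrA.
have -> : \sum_i \sum_j \sum_k A j i * A i j * A k k = t2 * t.
  rewrite -tr2 mulr_suml; apply: eq_bigr => i _; rewrite mulr_suml.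
  by apply: eq_bigr => j _; rewrite -tE mulr_sumr; apply: eq_bigr => k _; ring.
have -> : \sum_i \sum_j \sum_k A k i * A j j * A i k = t2 * t.
  rewrite -tr2 mulr_suml; apply: eq_bigr => i _; rewrite exchange_big mulr_suml.
  by apply: eq_bigr => k _; rewrite -tE mulr_sumr; apply: eq_bigr => j _; ring.
have -> : \sum_i \sum_j \sum_k A i i * A k j * A j k = t * t2.
  rewrite -tE mulr_suml; apply: eq_bigr => i _; rewrite -tr2 mulr_sumr.
  by apply: eq_bigr => j _; rewrite mulr_sumr; apply: eq_bigr => k _; ring.
have -> : \sum_i \sum_j \sum_k A k i * A i j * A j k = t3.
  rewrite -tr3; apply: eq_bigr => i _; apply: eq_bigr => j _; apply: eq_bigr => k _; ring.
have -> : \sum_i \sum_j \sum_k A j i * A k j * A i k = t3.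
  rewrite -tr3; apply: eq_bigr => i _; rewrite exchange_big.
  by apply: eq_bigr => k _; apply: eq_bigr => j _; ring.
by congr (_ * _); ring.
Qed.

End SmallTensorPowers.

(** * The cubic bound *)

Section CubicMoments.
Context {R : realType}.
Variable d : nat.
Hypothesis d_gt0 : (0 < d)%N.
Local Notation D := (d%:R : R).

(* A law on {0, opt_node, d} can match the first three moments of t for a pure
   state under a 3-design; this is why the tangency point is chosen here. *)
Definition opt_node : R := 2 * D / (D + 2).

(** After rescaling by [opt_node] the tangency point is 1 and the endpoint [d] becomes
    [d / opt_node = (d + 2) / 2], the second contact point of [ln_le_quad]. *)
Definition opt_curv : R := ln_curv ((D + 2) / 2).

(** The cubic that dominates [t * ln t] is [t * ln_quad t]. *)
Definition ln_quad (t : R) : R :=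
  ln opt_node + (t / opt_node - 1) + opt_curv * (t / opt_node - 1) ^+ 2.

Lemma opt_node_gt0 : 0 < opt_node.
Proof. have D1 : 1 <= D by rewrite ler1n. rewrite /opt_node divr_gt0 //; lra. Qed.

Let div_node : D / opt_node = (D + 2) / 2.
Proof. have D1 : 1 <= D by rewrite ler1n. rewrite /opt_node; field; lra. Qed.

Lemma ln_le_ln_quad t : 0 < t <= D -> ln t <= ln_quad t.
Proof.
move=> /andP[t0 tD]; have a0 := opt_node_gt0; have D1 : 1 <= D by rewrite ler1n.
have ta0 : 0 < t / opt_node by rewrite divr_gt0.
have -> : ln t = ln opt_node + ln (t / opt_node).
  by rewrite -lnM ?posrE // mulrCA divff ?mulr1 // gt_eqF.
rewrite /ln_quad -addrA.
rewrite lerD2l ln_le_quad //; first lra.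
by rewrite ta0 /= -div_node ler_pM2r // invr_gt0.
Qed.

(** A crude bound suffices: it supplies the constant [K] that makes [p * r] integrable. *)
Lemma ln_quad_bounded t : 0 <= t <= D -> `|ln_quad t| <=
  `|ln opt_node| + ((D + 2) / 2 + 1) + `|opt_curv| * ((D + 2) / 2 + 1) ^+ 2.
Proof.
move=> /andP[t0 tD]; have a0 := opt_node_gt0; have D1 : 1 <= D by rewrite ler1n.
have h : `|t / opt_node - 1| <= (D + 2) / 2 + 1.
  have t1 : 0 <= t / opt_node by rewrite divr_ge0 // ltW.
  have t2 : t / opt_node <= (D + 2) / 2 by rewrite -div_node ler_pM2r // invr_gt0.
  by rewrite ler_norml; lra.
rewrite /ln_quad (le_trans (ler_normD _ _)) // lerD //.
  by rewrite (le_trans (ler_normD _ _)) // lerD.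
by rewrite normrM normrX ler_wpM2l // lerXn2r ?nnegrE.
Qed.

(* [opt_curv <= 0] lets the lower bound on [S3] replace [S3]; [opt_curv >= -1/2]
   makes the result increasing in [S2], so that pure states are extremal. *)
Lemma cubic_moment_le (P S2 S3 : R) : 0 < P -> S2 <= P ^+ 2 ->
  2 * P * S2 - P ^+ 3 <= S3 ->
  (ln opt_node - 1 + opt_curv) * P +
  ((1 - 2 * opt_curv) / opt_node * (D / P)) * ((P ^+ 2 + S2) / (D + 1)) +
  (opt_curv / opt_node ^+ 2 * (D / P) ^+ 2) *
    ((P ^+ 3 + 3 * P * S2 + 2 * S3) / ((D + 1) * (D + 2))) <= W3 R d * P.
Proof.
move=> P0 hS2 hS3; set k := opt_curv; have D1 : 1 <= D by rewrite ler1n.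
have /andP[k1 k0] : - 2^-1 <= k <= 0 by apply: ln_curv_bounds; lra.
(* Here [u - 1 = D / 2] for [u = (D + 2) / 2], so [k * (D / 2)] carries the logarithm that occurs in
   [W3]. *)
have kE : k * (D / 2) = 2 * ln ((D + 2) / 2) / D - 1.
  rewrite /k /opt_curv /ln_curv; field; lra.
set L := ln ((D + 2) / 2) in kE.
have WE : W3 R d = ln opt_node + (D + 1)^-1 + (k * (D / 2)) / (D + 1).
  by rewrite /W3 -/opt_node -/L kE; field; lra.
(* Pass to the normalized state, of purity [s2], and factor out [P]. *)
pose s2 := S2 / P ^+ 2; pose s3 := S3 / P ^+ 3.
have S2E : S2 = s2 * P ^+ 2 by rewrite divfK // expf_neq0 // gt_eqF.
have S3E : S3 = s3 * P ^+ 3 by rewrite divfK // expf_neq0 // gt_eqF.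
have s2_le1 : s2 <= 1 by rewrite ler_pdivrMr ?exprn_gt0 // mul1r.
have s3_ge : 2 * s2 - 1 <= s3.
  rewrite ler_pdivlMr ?exprn_gt0 //; move: hS3; rewrite S2E.
  by congr (_ <= _); ring.
have -> : (ln opt_node - 1 + k) * P +
  ((1 - 2 * k) / opt_node * (D / P)) * ((P ^+ 2 + S2) / (D + 1)) +
  (k / opt_node ^+ 2 * (D / P) ^+ 2) *
    ((P ^+ 3 + 3 * P * S2 + 2 * S3) / ((D + 1) * (D + 2))) =
  (ln opt_node - 1 + k + (D + 2) / (D + 1) *
    ((1 - 2 * k) / 2 * (1 + s2) + k / 4 * (1 + 3 * s2 + 2 * s3))) * P.
  rewrite S2E S3E; set l := ln _; rewrite /opt_node; field.
  by rewrite !gt_eqF //; lra.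
rewrite ler_pM2r // WE.
have c0 : 0 < (D + 2) / (D + 1) by rewrite divr_gt0; lra.
(* The right side is the value at a pure state, [s2 = s3 = 1]. Once [s3] is replaced by
   [2 * s2 - 1], the coefficient of [s2] is [1 / 2 + 3 * k / 4], positive since [k >= - 1 / 2]. *)
have le1 : (1 - 2 * k) / 2 * (1 + s2) + k / 4 * (1 + 3 * s2 + 2 * s3) <=
  1 - k / 2.
  have : k * (s3 - (2 * s2 - 1)) <= 0 by rewrite mulr_le0_ge0 // subr_ge0.
  have : 0 <= (1 / 2 + 3 * k / 4) * (1 - s2) by rewrite mulr_ge0 //; lra.
  by nra.
have le2 := ler_wpM2l (ltW c0) le1.
have e0 : (D + 1)^-1 = (D + 2) / (D + 1) - 1 by field; lra.
have e : k * (D / 2) / (D + 1) = k - (D + 2) / (D + 1) * (k / 2) by field; lra.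
rewrite e; lra.
Qed.

End CubicMoments.

(** * Moments of a 3-design POVM *)

Section ComplexMeasurable.
Context d (T : measurableType d) (R : realType).
Implicit Types (f g : T -> R[i]).

Definition cmeasurable f : Prop :=
  measurable_fun setT (fun x => Re (f x)) /\ measurable_fun setT (fun x => Im (f x)).

Lemma cmeasurable_cst (c : R[i]) : cmeasurable (fun=> c).
Proof. by split; exact: measurable_cst. Qed.

Lemma cmeasurableD f g : cmeasurable f -> cmeasurable g -> cmeasurable (fun x => f x + g x).
Proof.
move=> [f1 f2] [g1 g2]; split.
  rewrite (_ : (fun _ => _) = (fun x => Re (f x) + Re (g x))); first exact: measurable_funD.
  by apply/funext => x; case: (f x) (g x) => [? ?] [? ?].
rewrite (_ : (fun _ => _) = (fun x => Im (f x) + Im (g x))); first exact: measurable_funD.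
by apply/funext => x; case: (f x) (g x) => [? ?] [? ?].
Qed.

Lemma cmeasurableM f g : cmeasurable f -> cmeasurable g -> cmeasurable (fun x => f x * g x).
Proof.
move=> [f1 f2] [g1 g2]; split.
  rewrite (_ : (fun _ => _) = (fun x => Re (f x) * Re (g x) - Im (f x) * Im (g x))).
    by apply: measurable_funB; exact: measurable_funM.
  by apply/funext => x; case: (f x) (g x) => [? ?] [? ?].
rewrite (_ : (fun _ => _) = (fun x => Re (f x) * Im (g x) + Im (f x) * Re (g x))).
  by apply: measurable_funD; exact: measurable_funM.
by apply/funext => x; case: (f x) (g x) => [? ?] [? ?].
Qed.

Lemma cmeasurableV f : cmeasurable f -> cmeasurable (fun x => (f x)^-1).
Proof.
move=> [f1 f2].
have n2 : measurable_fun setT (fun x => (Re (f x) ^+ 2 + Im (f x) ^+ 2)^-1).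
  by apply: measurable_funV; apply: measurable_funD; exact: measurable_funX.
split.
  rewrite (_ : (fun _ => _) = (fun x => Re (f x) * (Re (f x) ^+ 2 + Im (f x) ^+ 2)^-1)).
    exact: measurable_funM.
  by apply/funext => x; case: (f x).
rewrite (_ : (fun _ => _) = (fun x => - (Im (f x) * (Re (f x) ^+ 2 + Im (f x) ^+ 2)^-1))).
  by apply: measurableT_comp => //; exact: measurable_funM.
by apply/funext => x; case: (f x).
Qed.

Lemma cmeasurable_sum (I : Type) (s : seq I) (F : I -> T -> R[i]) :
  (forall i, cmeasurable (F i)) -> cmeasurable (fun x => \sum_(i <- s) F i x).
Proof.
move=> mF; elim: s => [|i s IHs].
  rewrite (_ : (fun _ => _) = cst 0); first exact: cmeasurable_cst.
  by apply/funext => x; rewrite big_nil.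
rewrite (_ : (fun _ => _) = (fun x => F i x + \sum_(j <- s) F j x)).
  exact: cmeasurableD.
by apply/funext => x; rewrite big_cons.
Qed.

Lemma cmeasurable_prod (I : Type) (s : seq I) (F : I -> T -> R[i]) :
  (forall i, cmeasurable (F i)) -> cmeasurable (fun x => \prod_(i <- s) F i x).
Proof.
move=> mF; elim: s => [|i s IHs].
  rewrite (_ : (fun _ => _) = cst 1); first exact: cmeasurable_cst.
  by apply/funext => x; rewrite big_nil.
rewrite (_ : (fun _ => _) = (fun x => F i x * \prod_(j <- s) F j x)).
  exact: cmeasurableM.
by apply/funext => x; rewrite big_cons.
Qed.

End ComplexMeasurable.

Lemma cmeasurable_comp d d' (T : measurableType d) (T' : measurableType d')
    (R : realType) (g : T' -> T) (f : T -> R[i]) :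
  measurable_fun setT g -> cmeasurable f -> cmeasurable (f \o g).
Proof. by move=> mg [f1 f2]; split; [exact: (measurableT_comp f1 mg)|exact: (measurableT_comp f2 mg)]. Qed.

(** * Integrals with finite value, and traces of matrix integrals *)

Section HasIntegral.
Context d (T : measurableType d) (R : realType) (mu : {measure set T -> \bar R}).
Implicit Types (f g : T -> R) (a b c : R).

Definition has_integral f c : Prop :=
  mu.-integrable setT (EFin \o f) /\ (\int[mu]_x (f x)%:E = c%:E)%E.

(** A finite value forces the positive and negative parts to have finite integrals, hence
    integrability. *)
Lemma has_integralP f c : measurable_fun setT f ->
  (\int[mu]_x (f x)%:E = c%:E)%E -> has_integral f c.
Proof.
move=> mf fc; split => //; apply/integrableP; split; first exact/measurable_EFinP.
by rewrite integral_fin_num_abs // fc.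
Qed.

Lemma has_integralD f g a b : has_integral f a -> has_integral g b ->
  has_integral (fun x => f x + g x) (a + b).
Proof.
move=> [f1 f2] [g1 g2]; split.
  by have := integrableD measurableT f1 g1.
by rewrite (integralD_EFin measurableT f1 g1) f2 g2.
Qed.

Lemma has_integralZ k f a : has_integral f a -> has_integral (fun x => k * f x) (k * a).
Proof.
move=> [f1 f2]; split; first by have := integrableZl measurableT k f1.
by under eq_integral do rewrite EFinM; rewrite (integralZl measurableT f1) f2.
Qed.

Lemma has_integral_sum (I : Type) (s : seq I) (F : I -> T -> R) (c : I -> R) :
  (forall i, has_integral (F i) (c i)) ->
  has_integral (fun x => \sum_(i <- s) F i x) (\sum_(i <- s) c i).
Proof.
move=> hF; elim: s => [|i s IHs].
  rewrite big_nil (_ : (fun _ => _) = cst 0); last by apply/funext => x; rewrite big_nil.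
  by apply: has_integralP; [exact: measurable_cst|rewrite integral0].
rewrite big_cons (_ : (fun _ => _) = (fun x => F i x + \sum_(j <- s) F j x)).
  exact: has_integralD.
by apply/funext => x; rewrite big_cons.
Qed.

End HasIntegral.

Section MatrixIntegral.
Context {R : realType}.
Local Notation mu := (@lebesgue_measure R).
Local Notation C := R[i].

Lemma ReD (x y : C) : Re (x + y) = Re x + Re y.
Proof. by case: x y => [? ?] [? ?]. Qed.

Lemma ReM (x y : C) : Re (x * y) = Re x * Re y + - Im x * Im y.
Proof. by case: x y => [? ?] [? ?] /=; rewrite mulNr. Qed.

Lemma Re_sum (I : Type) (s : seq I) (F : I -> C) :
  Re (\sum_(i <- s) F i) = \sum_(i <- s) Re (F i).
Proof.
by elim: s => [|i s IHs]; rewrite ?big_nil // !big_cons ReD IHs.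
Qed.

Lemma measurable_mxP m n (F : R -> 'M[C]_(m, n)) :
  measurable_mx F <-> forall i j,
    cmeasurable ((fun x => F x i j) : measurableTypeR R -> C).
Proof. by []. Qed.

(** The real part of the trace is a real linear combination of the real and imaginary parts of the
    entries, whose integrals are given. *)
Lemma has_integral_mxtrace m n (F : R -> 'M[C]_(m, n)) (A : 'M[C]_(m, n))
    (M : 'M[C]_(n, m)) : measurable_mx F -> has_mx_integral F A ->
  has_integral mu (fun x => Re (\tr (M *m F x))) (Re (\tr (M *m A))).
Proof.
move=> mF iF.
have trE B : Re (\tr (M *m B)) =
    \sum_i \sum_j (Re (M i j) * Re (B j i) + - Im (M i j) * Im (B j i)).
  rewrite Re_sum; apply: eq_bigr => i _; rewrite mxE Re_sum.
  by apply: eq_bigr => j _; rewrite ReM.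
rewrite trE (_ : (fun _ => _) = fun x =>
    \sum_i \sum_j (Re (M i j) * Re (F x j i) + - Im (M i j) * Im (F x j i))).
  apply: has_integral_sum => i; apply: has_integral_sum => j.
  have [mRe mIm] := mF j i; have [iRe iIm] := iF j i.
  by apply: has_integralD; apply: has_integralZ; exact: has_integralP.
by apply/funext => x; rewrite trE.
Qed.

End MatrixIntegral.

(** * Normalizing constants of the second and third moments *)

Section DesignCoefficients.
Context {F : numFieldType} (d : nat).
Hypothesis d_gt0 : (0 < d)%N.

(** The factor [2^-1] is the one from averaging over ['S_2]; it cancels the factorial in the
    binomial coefficient. *)
Lemma design_coef2 : d%:R / 'C((d - 1 + 2)%N, 2)%:R * 2^-1 = (d%:R + 1)^-1 :> F.
Proof.
have bE : 'C((d - 1 + 2)%N, 2)%:R * 2 = d%:R * (d%:R + 1) :> F.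
  rewrite -[X in _ * X]/(2`!%:R) -natrM bin_ffact; case: d d_gt0 => // n _.
  by rewrite subn1 /= addn2 !ffactnS ffactn0 /= muln1 natrM mulrC -!natr1.
have d0 : (d%:R : F) != 0 by rewrite pnatr_eq0 -lt0n.
by rewrite -mulrA -invfM bE invfM mulVKf.
Qed.

Lemma design_coef3 :
  d%:R / 'C((d - 1 + 3)%N, 3)%:R * 6^-1 = ((d%:R + 1) * (d%:R + 2))^-1 :> F.
Proof.
have bE : 'C((d - 1 + 3)%N, 3)%:R * 6 = d%:R * ((d%:R + 1) * (d%:R + 2)) :> F.
  rewrite -[X in _ * X]/(3`!%:R) -natrM bin_ffact; case: d d_gt0 => // n _.
  by rewrite subn1 /= addn3 !ffactnS ffactn0 /= muln1 !natrM -!natr1; ring.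
have d0 : (d%:R : F) != 0 by rewrite pnatr_eq0 -lt0n.
by rewrite -mulrA -invfM bE invfM mulVKf.
Qed.

End DesignCoefficients.

Lemma ReK_ge0 (R : realType) (z : R[i]) : 0 <= z -> z = (Re z)%:C%C.
Proof. by move=> z0; rewrite RRe_real // ger0_real. Qed.

Lemma Re_mxtrace_mul_psdmx (R : realType) n (A B : 'M[R[i]]_n) : psdmx A -> psdmx B ->
  0 <= Re (\tr (A *m B)) <= Re (\tr A) * Re (\tr B).
Proof.
move=> Apsd Bpsd; have AB := mxtrace_mul_psdmx Apsd Bpsd; have /andP[AB0 _] := AB.
by move: AB; rewrite (ReK_ge0 AB0) (ReK_ge0 (mxtrace_psdmx_ge0 Apsd))
  (ReK_ge0 (mxtrace_psdmx_ge0 Bpsd)) -rmorphM ler0c lecR.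
Qed.

Section DesignMoments.
Context {R : realType} (d : nat).
Hypothesis d_gt0 : (0 < d)%N.
Local Notation mu := (@lebesgue_measure R).
Local Notation C := R[i].
(** [rho] stands for one value of the ensemble; it is not normalized, hence the powers of its trace
    [S1] in the moments. *)
Variables (E : R -> 'M[C]_d) (rho : 'M[C]_d).
Hypotheses (hE : is_design_povm 3 E) (rho_psd : psdmx rho).

Local Notation p y := (Re (\tr (rho *m E y))).
Local Notation tau y := (Re (\tr (E y))).
Local Notation S1 := (Re (\tr rho)).
Local Notation S2 := (Re (\tr (rho *m rho))).
Local Notation S3 := (Re (\tr (rho *m rho *m rho))).

Let mE : measurable_mx E. Proof. by have [[]] := hE. Qed.

Let E_psd y : psdmx (E y). Proof. by have [[_ /(_ y)[]]] := hE. Qed.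

Lemma measurable_design k : measurable_mx (fun y => (\tr (E y) ^+ k.-1)^-1 *: tens_pow k (E y)).
Proof.
apply/measurable_mxP => a b.
rewrite (_ : (fun _ => _) = (fun y => (\prod_(i < k.-1) \sum_i E y i i)^-1 *
  \prod_(l < k) E y ((enum_val a : {ffun 'I_k -> 'I_d}) l)
                    ((enum_val b : {ffun 'I_k -> 'I_d}) l))); last first.
  by apply/funext => y; rewrite !mxE prodr_const card_ord.
apply: cmeasurableM; last by apply: cmeasurable_prod => l; exact: mE.
apply/cmeasurableV/cmeasurable_prod => _; apply: cmeasurable_sum => i; exact: mE.
Qed.

Let pE y : \tr (rho *m E y) = (p y)%:C%C.
Proof. by apply: ReK_ge0; have /andP[] := mxtrace_mul_psdmx rho_psd (E_psd y). Qed.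

Let tauE y : \tr (E y) = (tau y)%:C%C.
Proof. exact/ReK_ge0/mxtrace_psdmx_ge0. Qed.

Let S1E : \tr rho = S1%:C%C.
Proof. exact/ReK_ge0/mxtrace_psdmx_ge0. Qed.

Let S2E : \tr (rho *m rho) = S2%:C%C.
Proof. by apply: ReK_ge0; have /andP[] := mxtrace_mul_psdmx rho_psd rho_psd. Qed.

Lemma has_integral_joint : has_integral mu (fun y => p y) S1.
Proof.
have [[_ _ iE] _] := hE.
by have := has_integral_mxtrace rho mE iE; rewrite mulmx1.
Qed.

Lemma has_integral_tau : has_integral mu (fun y => tau y) d%:R.
Proof.
have [[_ _ iE] _] := hE.
have := has_integral_mxtrace 1%:M mE iE; rewrite mulmx1 mxtrace1.
rewrite (_ : (fun _ => _) = (fun y => tau y)); last by apply/funext => y; rewrite mul1mx.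
by rewrite (_ : Re _ = d%:R) // -(rmorph_nat (real_complex R)).
Qed.

(** Pair the design identity with the tensor power of [rho]: the trace of a product of tensor powers
    is [p y ^+ k]. *)
Lemma has_integral_design k : (1 <= k <= 3)%N ->
  has_integral mu (fun y => (tau y ^+ k.-1)^-1 * p y ^+ k)
    (Re (d%:R / 'C((d - 1 + k)%N, k)%:R * \tr (tens_pow k rho *m Psym d k))).
Proof.
move=> hk; have [_ /(_ k hk) iE] := hE.
have := has_integral_mxtrace (tens_pow k rho) (@measurable_design k) iE.
rewrite -scalemxAr linearZ /=.
rewrite (_ : (fun _ => _) = (fun y => (tau y ^+ k.-1)^-1 * p y ^+ k)) //.
apply/funext => y; rewrite -scalemxAr linearZ /= tens_pow_mul mxtrace_tens_pow.
by rewrite pE tauE -!rmorphXn -fmorphV -rmorphM.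
Qed.

Lemma has_integral_joint2 :
  has_integral mu (fun y => (tau y)^-1 * p y ^+ 2) ((S1 ^+ 2 + S2) / (d%:R + 1)).
Proof.
have := @has_integral_design 2 isT; rewrite mxtrace_tens_pow2_Psym S1E S2E.
have -> : d%:R / 'C((d - 1 + 2)%N, 2)%:R * (2^-1 * (S1%:C%C ^+ 2 + S2%:C%C)) =
    ((S1 ^+ 2 + S2) / (d%:R + 1))%:C%C :> C.
  rewrite !(rmorphD, rmorphM, rmorphXn, fmorphV, rmorph_nat, rmorph1) /=.
  by rewrite mulrA design_coef2 // mulrC.
by [].
Qed.

Let S3E : \tr (rho *m rho *m rho) = S3%:C%C.
Proof.
apply/ReK_ge0/mxtrace_psdmx_ge0; rewrite -[X in _ *m X](psdmx_herm rho_psd).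
exact: psdmx_conj.
Qed.

Lemma has_integral_joint3 :
  has_integral mu (fun y => (tau y ^+ 2)^-1 * p y ^+ 3)
    ((S1 ^+ 3 + 3 * S1 * S2 + 2 * S3) / ((d%:R + 1) * (d%:R + 2))).
Proof.
have := @has_integral_design 3 isT; rewrite mxtrace_tens_pow3_Psym S1E S2E S3E.
have -> : d%:R / 'C((d - 1 + 3)%N, 3)%:R *
    (6^-1 * (S1%:C%C ^+ 3 + 3 * S1%:C%C * S2%:C%C + 2 * S3%:C%C)) =
    ((S1 ^+ 3 + 3 * S1 * S2 + 2 * S3) / ((d%:R + 1) * (d%:R + 2)))%:C%C :> C.
  rewrite !(rmorphD, rmorphM, rmorphXn, fmorphV, rmorph_nat, rmorph1) /=.
  by rewrite mulrA design_coef3 // mulrC.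
by [].
Qed.

Let S1_ge0 : 0 <= S1.
Proof. by rewrite -ler0c -S1E mxtrace_psdmx_ge0. Qed.

Let p_bounds y : 0 <= p y <= S1 * tau y.
Proof. exact: Re_mxtrace_mul_psdmx. Qed.

Let S2_le : S2 <= S1 ^+ 2.
Proof.
have /andP[_] := mxtrace_mul_psdmx rho_psd rho_psd.
by rewrite S2E S1E -rmorphM lecR expr2.
Qed.

Let S3_ge : 2 * S1 * S2 - S1 ^+ 3 <= S3.
Proof.
have := mxtrace_cube_ge rho_psd.
by rewrite S3E S2E S1E -(rmorph_nat (real_complex R)) -rmorphXn -!rmorphM -rmorphB lecR.
Qed.

(** The integrand is a combination of the three integrands [p], [p ^+ 2 / tau] and
    [p ^+ 3 / tau ^+ 2], whose integrals the design property fixes; [cubic_moment_le] then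
    applies. *)
Lemma integral_ln_quad_le :
  (\int[mu]_y (p y * ln_quad d (p y / (S1 * (tau y / d%:R))))%:E <=
   (W3 R d * S1)%:E)%E.
Proof.
(* If [rho] has trace 0, then [p] vanishes identically and both sides are 0. *)
have [S10|S1n0] := eqVneq S1 0.
  rewrite S10 mulr0; under eq_integral => y _.
    have -> : p y = 0.
      by have := p_bounds y; rewrite S10 mul0r => h; apply/eqP; rewrite eq_le andbC.
    rewrite mul0r; over.
  by rewrite integral0.
have S1_gt0 : 0 < S1 by rewrite lt_def S1n0 S1_ge0.
have d0 : (d%:R : R) != 0 by rewrite pnatr_eq0 -lt0n.
set a := @opt_node R d; set k := @opt_curv R d.
have := has_integralD
  (has_integralD (has_integralZ (ln a - 1 + k) has_integral_joint)
    (has_integralZ ((1 - 2 * k) / a * (d%:R / S1)) has_integral_joint2))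
  (has_integralZ (k / a ^+ 2 * (d%:R / S1) ^+ 2) has_integral_joint3).
rewrite (_ : (fun _ => _) =
    (fun y => p y * ln_quad d (p y / (S1 * (tau y / d%:R))))).
  by move=> [_ ->]; rewrite lee_fin cubic_moment_le.
apply/funext => y; rewrite /ln_quad -/a -/k.
(* This also holds where [tau y = 0], by the convention [0^-1 = 0]; the expansion treats the inverse
   of [tau y] as a free variable. *)
have -> : p y / (S1 * (tau y / d%:R)) = d%:R / S1 * ((tau y)^-1 * p y).
  by rewrite !invfM invrK; ring.
by rewrite -!exprVn; move: a k (tau y)^-1 => a k ti; ring.
Qed.

End DesignMoments.

Theorem corollary3 (R : realType) (d : nat) (d_gt0 : (0 < d)%N)
    (E : R -> 'M[R[i]]_d) (hE : is_design_povm 3 E) :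
  (informational_power E <= (W3 R d)%:E)%E.
Proof.
apply: ge_ereal_sup => _ [rho [mrho rho_state int_rho] <-].
have [[mE E_eff _] _] := hE.
have rho_psd x : psdmx (rho x) by have [] := rho_state x.
have E_psd y : psdmx (E y) by have [] := E_eff y.
(* Completeness of the POVM makes the input marginal the trace of [rho x]. *)
have marg1 x : marginal1 rho E x = Re (\tr (rho x)).
  by rewrite /marginal1 /Rintegral (has_integral_joint (rho x) hE).2.
have D1 : 1 <= d%:R :> R by rewrite ler1n.
have d0 : 0 < d%:R :> R by lra.
have bnd x y : 0 <= joint rho E x y <= Re (\tr (rho x)) * Re (\tr (E y)).
  exact: Re_mxtrace_mul_psdmx.
have mtr F : measurable_mx F -> measurable_fun setT
    ((fun x => Re (\tr (F x))) : measurableTypeR R -> R).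
  by move=> mF; apply: (cmeasurable_sum _ _).1 => i; exact: mF.
have trge0 A : psdmx A -> 0 <= Re (\tr A) :> R.
  by move=> /mxtrace_psdmx_ge0 A0; rewrite -ler0c -ReK_ge0.
pose K : R := `|ln (opt_node d)| + ((d%:R + 2) / 2 + 1) +
  `|opt_curv d| * ((d%:R + 2) / 2 + 1) ^+ 2.
pose mu := @lebesgue_measure R.
(* The reference output density is [Tr[E y] / d]; since the joint density is at most [Tr[rho x] *
   Tr[E y]], the likelihood ratio is at most [d]. *)
have le := @mutual_info_le _ _ _ _ R mu mu (fun z => joint rho E z.1 z.2)
  (fun x => Re (\tr (rho x))) (fun y => Re (\tr (E y)) / d%:R) (ln_quad d) d%:R K (W3 R d).
rewrite /mutual_info; under eq_integral do rewrite marg1.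
apply: le => //=.
- rewrite /joint (_ : (fun _ => _) = fun z : measurableTypeR R * measurableTypeR R =>
      Re (\sum_i \sum_j rho z.1 i j * E z.2 j i)).
    apply: (cmeasurable_sum _ _).1 => i; apply: cmeasurable_sum => j.
    apply: cmeasurableM.
      exact: (cmeasurable_comp (f := fun x => rho x i j) measurable_fst (mrho i j)).
    exact: (cmeasurable_comp (f := fun x => E x j i) measurable_snd (mE j i)).
  by apply/funext => z; congr Re; apply: eq_bigr => i _; rewrite mxE.
- exact: mtr.
- by apply: measurable_funM => //; exact: mtr.
- apply: measurable_funD; last first.
    apply: measurable_funM => //; apply: measurable_funX.
    by apply: measurable_funB => //; apply: measurable_funM.
  by apply: measurable_funD => //; apply: measurable_funB => //; apply: measurable_funM.
- by move=> z; have /andP[] := bnd z.1 z.2.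
- by move=> x; exact: trge0.
- by move=> y; rewrite divr_ge0 ?trge0.
- by move=> x y; have /andP[_] := bnd x y; rewrite mulrCA [_ * (_ / _)]mulrC divfK ?gt_eqF.
- by move=> x; rewrite /joint (has_integral_joint (rho x) hE).2.
(* The reference density integrates to 1 because [Tr[E y]] integrates to the trace of the identity,
   which is [d]. *)
- have [_ h] := has_integralZ d%:R^-1 (has_integral_tau hE).
  by under eq_integral do rewrite mulrC; rewrite h mulVf ?gt_eqF.
- exact: ln_le_ln_quad.
- exact: ln_quad_bounded.
- by move=> x; exact: integral_ln_quad_le.
Qed.
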